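(* Let $d\in\mathbb{N}$ and let $\varphi\colon(0,1)\to[0,d]$ be a function. Then there exists a set $F\subset\mathbb{R}^d$ such that $\dim_{\mathrm{A}}^{\theta}F=\varphi(\theta)$ for all $\theta\in(0,1)$ if and only if for every $0<\lambda<\theta<1$, $$0\leq (1-\lambda)\varphi(\lambda)-(1-\theta)\varphi(\theta)\leq (\theta-\lambda)\,\varphi\Bigl(\frac{\lambda}{\theta}\Bigr).$$
   Context: $\mathbb{R}^d$ carries the Euclidean norm and $B(x,\delta)$ is the open ball of centre $x$ and radius $\delta$. For bounded $E\subset\mathbb{R}^d$ and $\delta>0$, $N_\delta(E)$ is the least number of balls of radius $\delta$ required to cover $E$. For $\theta\in(0,1)$ the Assouad spectrum of $F\subset\mathbb{R}^d$ is $$\dim_{\mathrm{A}}^{\theta}F=\inf\Bigl\{\alpha:(\exists C>0)(\forall\, 0<\delta\leq 1)(\forall x\in F)\ N_{\delta^{1/\theta}}(F\cap B(x,\delta))\leq C\Bigl(\frac{\delta}{\delta^{1/\theta}}\Bigr)^{\alpha}\Bigr\}.$$ *)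

(* Defs.v *)
From mathcomp Require Export all_boot all_order all_algebra.
From mathcomp Require Export all_classical all_reals all_analysis.

Set Implicit Arguments.
Unset Strict Implicit.
Unset Printing Implicit Defensive.

Import Order.TTheory GRing.Theory Num.Theory.

Local Open Scope classical_set_scope.
Local Open Scope ring_scope.

(* The library's norm and [ball] on ['rV[R]_d] are those of the sup norm, hence
   the explicit Euclidean versions. *)
Definition enorm (R : realType) (d : nat) (x : 'rV[R]_d) : R :=
  Num.sqrt (\sum_(i < d) (x ord0 i) ^+ 2).

Definition eball (R : realType) (d : nat) (x : 'rV[R]_d) (delta : R) :
    set 'rV[R]_d :=
  [set y | enorm (y - x) < delta].

Definition covers (R : realType) (d : nat) (delta : R) (E : set 'rV[R]_d)
    (n : nat) : Prop :=
  exists c : 'I_n -> 'rV[R]_d, E `<=` \bigcup_(i : 'I_n) eball (c i) delta.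

(* An infimum of natural numbers, so a minimum when E is bounded and delta > 0;
   it is +oo when there is no finite cover. The centres need not lie in E. *)
Definition covering_number (R : realType) (d : nat) (delta : R)
    (E : set 'rV[R]_d) : \bar R :=
  ereal_inf [set (n%:R)%:E | n in [set n : nat | covers delta E n]].

(* The infimum is over all real exponents and is taken in the extended reals:
   the empty set has Assouad spectrum -oo. *)
Definition assouad_spectrum (R : realType) (d : nat) (theta : R)
    (F : set 'rV[R]_d) : \bar R :=
  ereal_inf [set alpha%:E | alpha in [set alpha : R |
    exists2 C : R, 0 < C &
      forall delta : R, 0 < delta <= 1 ->
      forall x : 'rV[R]_d, F x ->
        (covering_number (delta `^ theta^-1) (F `&` eball x delta)
           <= (C * (delta / delta `^ theta^-1) `^ alpha)%:E)%E]].

(* Main.v *)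
Require Import Defs.
From mathcomp Require Import all_boot all_order all_algebra.
From mathcomp Require Import all_classical all_reals all_analysis.
From mathcomp Require Import ring lra zify.

Set Implicit Arguments.
Unset Strict Implicit.
Unset Printing Implicit Defensive.

Import Order.TTheory GRing.Theory Num.Theory.

Local Open Scope classical_set_scope.
Local Open Scope ring_scope.

(* Put psi t = (1 - t) phi t. With r = delta^(1/theta), the Assouad spectrum is
   phi iff psi theta is, for each theta, the least exponent a with
   N_r(F & B(x, r^theta)) <~ r^(-a); the condition on phi reads
   0 <= psi lambda - psi theta <= theta psi(lambda / theta).
   Necessity: the first inequality is monotonicity of N_r in the ball, and the
   second follows by covering first at scale r^theta and then at scale r.
   Sufficiency: the condition makes psi nonincreasing and d-Lipschitz, so for each
   n there is a homogeneous finite dyadic set of depth n, each of whose cubes of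
   side 2^(-k) contains about 2^(n (psi(k/n) - psi(l/n))) of its cubes of side
   2^(-l). The inequality psi(theta v) - psi v <= v psi theta bounds all its
   covering numbers at once, and testing at the scale r = 2^(-n-1) shows that the
   bound is sharp as n tends to infinity. As delta <= 1, translating these sets
   far apart makes their union behave locally like a single one of them. *)

(** * Euclidean norm and covering numbers *)

Section EuclideanNorm.
Variables (R : realType) (d : nat).
Implicit Types (x y : 'rV[R]_d) (E : set 'rV[R]_d).

Lemma coord_le_enorm x i : `|x ord0 i| <= enorm x.
Proof.
rewrite /enorm -sqrtr_sqr ler_wsqrtr // (bigD1 i) //= lerDl.
by apply: sumr_ge0 => j _; apply: sqr_ge0.
Qed.

(** The factor [2 ^+ d] stands in for the square root of [d]: being a power of two, it merely shifts
    dyadic scales by [d], and [d < 2 ^ d] keeps the inequality strict. *)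
Lemma enorm_lt x (M : R) : 0 < M -> (forall i, `|x ord0 i| < M) ->
  enorm x < 2 ^+ d * M.
Proof.
move=> M0 xM; have dM0 : 0 < 2 ^+ d * M by rewrite mulr_gt0 // exprn_gt0.
rewrite /enorm -(gtr0_norm dM0) -sqrtr_sqr ltr_sqrt ?exprn_gt0 //.
apply: (@le_lt_trans _ _ (\sum_(i < d) M ^+ 2)).
  by apply: ler_sum => i _; rewrite -real_normK ?num_real // lerXn2r ?nnegrE // ltW.
rewrite sumr_const card_ord -[X in X < _]mulr_natl exprMn ltr_pM2r ?exprn_gt0 //.
rewrite -exprM -natrX ltr_nat (leq_trans (ltn_expl d (ltnSn 1))) // leq_exp2l //.
by rewrite leq_pmulr.
Qed.

Lemma covers_seqP (delta : R) E n : covers delta E n <->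
  exists2 s : seq 'rV[R]_d, (size s <= n)%N &
    forall y, E y -> exists2 c, c \in s & enorm (y - c) < delta.
Proof.
split=> [[c Ec]|[s sn Es]].
  exists (map c (enum 'I_n)); first by rewrite size_map size_enum_ord.
  by move=> y /Ec[i _ yi]; exists (c i) => //; rewrite map_f ?mem_enum.
exists (fun i => nth 0 s i) => y /Es[c cs yc].
have ltn : (index c s < n)%N by rewrite (leq_trans _ sn) ?index_mem.
by exists (Ordinal ltn) => //=; rewrite /eball /= nth_index.
Qed.

Lemma covers_leq (delta : R) E m n : (m <= n)%N ->
  covers delta E m -> covers delta E n.
Proof.
move=> mn /covers_seqP[s sm Es]; apply/covers_seqP.
by exists s => //; apply: leq_trans mn.
Qed.

Lemma covers_subset (delta : R) E1 E2 n : E1 `<=` E2 ->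
  covers delta E2 n -> covers delta E1 n.
Proof. by move=> E12 [c Ec]; exists c; apply: subset_trans Ec. Qed.

Lemma covers_bigcup (delta : R) E (I : finType) (A : I -> set 'rV[R]_d) m :
  E `<=` \bigcup_i A i -> (forall i, covers delta (E `&` A i) m) ->
  covers delta E (#|I| * m).
Proof.
move=> EA /choice[c Ec]; apply/covers_seqP.
exists [seq c i j | i <- enum I, j <- enum 'I_m].
  by rewrite size_allpairs -cardE size_enum_ord.
move=> y Ey; have [i _ Aiy] := EA _ Ey; have [j _ yj] := Ec i y (conj Ey Aiy).
by exists (c i j) => //; apply: allpairs_f; rewrite mem_enum.
Qed.

(* A ball of radius s lies in M^d cells of side 2s/M. *)
Lemma covers_refine (s delta : R) E n m : 0 < s -> covers s E n ->
  (forall y, E y -> covers delta (E `&` eball y s) m) ->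
  covers delta E (n * (2 ^ d.+1) ^ d * m).
Proof.
(* With this [M] a cell has side [2 * s / M = s / 2 ^ d], so by [enorm_lt] it lies in the [s]-ball
   about any of its points. *)
move=> s0 [c Ec] Em; set M := (2 ^ d.+1)%N.
have M0 : (0 < M)%N by rewrite expn_gt0.
have MR0 : 0 < M%:R :> R by rewrite ltr0n.
pose q (x y : 'rV[R]_d) i := Num.trunc ((y ord0 i - x ord0 i + s) * M%:R / (2 * s)).
pose A (t : 'I_n * {ffun 'I_d -> 'I_M}) :=
  [set y | eball (c t.1) s y /\ forall i, q (c t.1) y i = t.2 i :> nat].
have -> : (n * M ^ d = #|{: 'I_n * {ffun 'I_d -> 'I_M}}|)%N.
  by rewrite card_prod card_ffun !card_ord.
have qP x y i : eball x s y -> 0 <= (y ord0 i - x ord0 i + s) * M%:R / (2 * s) < M%:R.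
  move=> xy; have := le_lt_trans (coord_le_enorm (y - x) i) xy.
  rewrite !mxE ltr_norml => /andP[l u].
  rewrite divr_ge0 ?mulr_ge0 ?ler0n //=; [|lra|lra].
  by rewrite ltr_pdivrMr ?mulr_gt0 // mulrC ltr_pM2l //; lra.
apply: (@covers_bigcup _ _ _ A) => [y Ey|[k f]].
  have [k _ yk] := Ec _ Ey.
  have qM i : (q (c k) y i < M)%N.
    by have /andP[? ?] := qP _ _ i yk; rewrite truncn_lt_nat.
  by exists (k, [ffun i => Ordinal (qM i)]) => //=; split=> // i; rewrite ffunE.
(* [Em] concerns points of [E] only, so a nonempty cell is handled through one of its own points
   [y]. *)
have [->|/set0P[y [Ey [cy yf]]]] := eqVneq (E `&` A (k, f)) set0.
  by apply/covers_seqP; exists [::].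
apply: covers_subset (Em y Ey) => z [Ez [cz zf]]; split=> //.
have -> : s = 2 ^+ d * (2 * s / M%:R).
  have : 2 ^+ d != 0 :> R by rewrite expf_neq0 // pnatr_eq0.
  by rewrite /M natrX exprS; set D := 2 ^+ d => D0; field.
apply: enorm_lt => [|i]; first by rewrite divr_gt0 // mulr_gt0.
have /andP[/truncn_itv/andP[l1 u1] _] := qP _ _ i cy.
have /andP[/truncn_itv/andP[l2 u2] _] := qP _ _ i cz.
move: (yf i) (zf i) l1 u1 l2 u2; rewrite /q /= => -> ->.
rewrite !ler_pdivlMr ?mulr_gt0 // !ltr_pdivrMr ?mulr_gt0 // -natr1 !mxE => l1 u1 l2 u2.
by rewrite ltr_norml -mulNr ltr_pdivrMr // ltr_pdivlMr //; apply/andP; split; nra.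
Qed.

(** The infimum is attained: a finite bound rules out an empty set of covers, and a nonempty set of
    naturals has a minimum. *)
Lemma covering_number_leP (delta : R) E (X : R) :
  (covering_number delta E <= X%:E)%E <->
  exists2 n, covers delta E n & n%:R <= X.
Proof.
split=> [EX|[n En nX]].
  have exn : exists n, `[< covers delta E n >].
    have [//|none] := pselect (exists n, `[< covers delta E n >]).
    move: EX; rewrite /covering_number.
    suff -> : [set n%:R%:E | n in [set n | covers delta E n]] = set0 :> set \bar R.
      by rewrite ereal_inf0 leye_eq.
    by rewrite -subset0 => y [n En] _; apply: none; exists n; apply: asboolT.
  case: (ex_minnP exn) => n /asboolP En nmin; exists n => //.
  rewrite -lee_fin (le_trans _ EX) //; apply: le_ereal_inf_tmp => _ [m Em <-].
  by rewrite lee_fin ler_nat nmin //; apply/asboolP.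
by apply: ge_ereal_inf; exists n%:R%:E; [exists n|rewrite lee_fin].
Qed.

End EuclideanNorm.

(** * The Assouad spectrum as a critical covering exponent *)

Section CoverExponent.
Variables (R : realType) (d : nat) (F : set 'rV[R]_d).
Implicit Types a v theta lambda r : R.

(* With r = delta^(1/theta) the defining inequality of the Assouad spectrum
   for alpha is the one for a = (1 - theta) alpha. *)
Definition cover_exponent theta a := exists2 C : R, 0 < C &
  forall r x, 0 < r <= 1 -> F x ->
    exists2 n, covers r (F `&` eball x (r `^ theta)) n & n%:R <= C * r `^ (- a).

Lemma powR_itv01 r a : 0 <= a -> 0 < r <= 1 -> 0 < r `^ a <= 1.
Proof.
move=> a0 /andP[r0 r1]; rewrite powR_gt0 //= -(powRr0 r).
by rewrite ger_powR // r0.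
Qed.

Lemma assouad_spectrumE theta : 0 < theta < 1 ->
  assouad_spectrum theta F = ereal_inf [set alpha%:E | alpha in
    [set alpha | cover_exponent theta ((1 - theta) * alpha)]].
Proof.
move=> /andP[t0 t1]; congr (ereal_inf (_ @` _)); apply/seteqP.
have pE (r alpha : R) : 0 < r -> (r `^ theta / r) `^ alpha = r `^ (- ((1 - theta) * alpha)).
  move=> r0; rewrite -[in X in _ / X](powRr1 (ltW r0)) -powRB ?(gt_eqF r0) ?implybT //.
  by rewrite -powRrM; congr (_ `^ _); ring.
have tK : forall q : R, 0 <= q -> (q `^ theta) `^ theta^-1 = q.
  by move=> q q0; rewrite -powRrM divff ?powRr1 // gt_eqF.
have tVK : forall q : R, 0 <= q -> (q `^ theta^-1) `^ theta = q.
  by move=> q q0; rewrite -powRrM mulVf ?powRr1 // gt_eqF.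
split=> alpha [C C0 HC]; exists C => //.
  move=> r x r01 Fx; have /HC/(_ x Fx) := powR_itv01 (ltW t0) r01.
  case/andP: r01 => r0 r1.
  by rewrite tK ?(ltW r0) // pE // => /covering_number_leP.
move=> r r01 x Fx; have tV0 : 0 <= theta^-1 by rewrite invr_ge0 ltW.
have [n] := HC _ x (powR_itv01 tV0 r01) Fx; case/andP: r01 => r0 r1.
rewrite -pE ?powR_gt0 // tVK ?(ltW r0) // => En nC.
by apply/covering_number_leP; exists n.
Qed.

Lemma cover_exponent_le theta a1 a2 : a1 <= a2 ->
  cover_exponent theta a1 -> cover_exponent theta a2.
Proof.
move=> a12 [C C0 HC]; exists C => // r x r01 Fx.
have [n En nC] := HC r x r01 Fx; exists n => //; apply: le_trans nC _.
by rewrite ler_pM2l // ger_powR // lerN2.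
Qed.

(** Admissible exponents are upward closed but need not contain their infimum, hence the strict
    inequality in the first half. *)
Lemma spectrum_eqP theta v : 0 < theta < 1 ->
  assouad_spectrum theta F = v%:E <->
  (forall a, (1 - theta) * v < a -> cover_exponent theta a) /\
  (forall a, cover_exponent theta a -> (1 - theta) * v <= a).
Proof.
move=> t01; rewrite assouad_spectrumE //; have t1 : 0 < 1 - theta by lra.
split=> [sv|[above below]].
  split=> a.
    move=> va; have : (v < a / (1 - theta))%R by rewrite ltr_pdivlMr // mulrC.
    rewrite -lte_fin -sv => /ereal_inf_lt[_ [alpha Halpha <-]].
    rewrite lte_fin ltr_pdivlMr // mulrC => /ltW; move/cover_exponent_le; exact.
  move=> Ha; rewrite mulrC -ler_pdivlMr // -lee_fin -sv.
  by apply: ereal_inf_lbound; exists (a / (1 - theta)) => //=; rewrite mulrC divfK ?gt_eqF.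
apply/eqP; rewrite eq_le; apply/andP; split.
  apply/lee_addgt0Pr => e e0; apply: ereal_inf_lbound.
  by exists (v + e) => //=; apply: above; rewrite ltr_pM2l // ltrDl.
apply: le_ereal_inf_tmp => _ [alpha Halpha <-].
by rewrite lee_fin -(ler_pM2l t1); apply: below.
Qed.

(** As [r <= 1], the larger exponent gives the smaller ball. This yields the lower inequality on
    [phi]. *)
Lemma cover_exponent_mono lambda theta a : lambda <= theta ->
  cover_exponent lambda a -> cover_exponent theta a.
Proof.
move=> lt [C C0 HC]; exists C => // r x r01 Fx.
have [n En nC] := HC r x r01 Fx; exists n => //; apply: covers_subset En.
move=> y [Fy xy]; split=> //; apply: lt_le_trans xy _.
by rewrite ger_powR.
Qed.

(** With [s = r ^ theta] the ball of radius [r ^ lambda] has radius [s ^ (lambda / theta)]: cover it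
    at scale [s], then each piece at scale [r]. The counts multiply, up to the constant of
    [covers_refine]. *)
Lemma cover_exponent_add lambda theta a b : 0 < theta ->
  cover_exponent (lambda / theta) b -> cover_exponent theta a ->
  cover_exponent lambda (a + theta * b).
Proof.
move=> t0 [C1 C10 H1] [C2 C20 H2].
pose K : R := ((2 ^ d.+1) ^ d)%:R.
have K0 : 0 < K by rewrite ltr0n expn_gt0 expn_gt0.
exists (C1 * C2 * K) => [|r x r01 Fx]; first by rewrite !mulr_gt0.
have s01 := powR_itv01 (ltW t0) r01.
have [n1] := H1 _ x s01 Fx; rewrite -!powRrM.
have -> : theta * (lambda / theta) = lambda by field; rewrite gt_eqF.
(* [covers_refine] needs a single count valid at every [y], so the real bound is truncated. *)
move=> cov1 n1C; pose m := Num.trunc (C2 * r `^ (- a)).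
have mC : m%:R <= C2 * r `^ (- a) by rewrite truncn_le mulr_ge0 ?powR_ge0 // ltW.
have [s0 _] := andP s01; exists (n1 * (2 ^ d.+1) ^ d * m)%N.
  apply: covers_refine s0 cov1 _ => y [Fy _]; have [n2 cov2 n2C] := H2 r y r01 Fy.
  apply: (@covers_leq _ _ _ _ n2); last by apply: covers_subset cov2 => z [[]].
  by rewrite truncn_ge_nat // mulr_ge0 ?powR_ge0 // ltW.
rewrite !natrM -/K (_ : _ * _ = (C1 * r `^ (theta * - b)) * K * (C2 * r `^ (- a))); last first.
  rewrite (_ : - (a + theta * b) = theta * - b + - a); last ring.
  have [r0 _] := andP r01; rewrite powRD ?(gt_eqF r0) ?implybT //.
  by ring.
by rewrite ler_pM ?mulr_ge0 ?ler0n ?(ltW K0) // ler_wpM2r // ltW.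
Qed.

End CoverExponent.

(** * Necessity of the two inequalities *)

Lemma spectrum_necessary (R : realType) (d : nat) (F : set 'rV[R]_d) (phi : R -> R) :
  (forall theta : R, 0 < theta < 1 -> assouad_spectrum theta F = (phi theta)%:E) ->
  forall lambda theta : R, 0 < lambda -> lambda < theta -> theta < 1 ->
     0 <= (1 - lambda) * phi lambda - (1 - theta) * phi theta
       <= (theta - lambda) * phi (lambda / theta).
Proof.
move=> HF lambda theta l0 lt t1; have t0 := lt_trans l0 lt.
have q01 : 0 < lambda / theta < 1 by rewrite divr_gt0 //= ltr_pdivrMr // mul1r.
have l01 : 0 < lambda < 1 by rewrite l0 (lt_trans lt).
have t01 : 0 < theta < 1 by rewrite t0 t1.
have [la lb] := (spectrum_eqP F (phi lambda) l01).1 (HF _ l01).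
have [ta tb] := (spectrum_eqP F (phi theta) t01).1 (HF _ t01).
have [qa qb] := (spectrum_eqP F (phi (lambda / theta)) q01).1 (HF _ q01).
apply/andP; split.
  rewrite subr_ge0; apply/ler_addgt0Pr => e e0; apply: tb.
  by apply: cover_exponent_mono (ltW lt) _; apply: la; rewrite ltrDl.
have -> : (theta - lambda) * phi (lambda / theta) =
    theta * ((1 - lambda / theta) * phi (lambda / theta)).
  by field; rewrite gt_eqF.
(* [qa] and [ta] require a strict excess, so [e] is halved; one half is divided by [theta], the
   factor that [cover_exponent_add] restores. *)
rewrite lerBlDr; apply/ler_addgt0Pr => e e0.
set p := _ * phi theta; set q := _ * phi (lambda / theta).
rewrite (_ : _ + e = (p + e / 2) + theta * (q + e / (2 * theta))); last first.
  by field; rewrite gt_eqF.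
apply: lb; apply: cover_exponent_add => //.
  by apply: qa; rewrite ltrDl divr_gt0 // mulr_gt0.
by apply: ta; rewrite ltrDl divr_gt0.
Qed.

(** * Counting dyadic points with prescribed free digits *)

Section BinaryDigits.
Local Open Scope nat_scope.
Variables (d : nat) (b : nat -> nat).
Implicit Types (p q w : {ffun 'I_d -> nat}) (A : {set 'I_d}) (k l n : nat).

(* The dyadic point p / 2^n of the unit cube has its l-th binary digits free
   in the first b l coordinates and zero in the others. *)
Definition digits n p := forall j, p j < 2 ^ n /\
  forall l, l < n -> odd (p j %/ 2 ^ (n - l.+1)) -> j < b l.

(** Names the dyadic cube of side 2^(-l) that contains [p / 2^n]. *)
Definition digit_prefix n l p : {ffun 'I_d -> nat} := [ffun j => p j %/ 2 ^ (n - l)].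

(** Appends a binary digit to each coordinate, 1 exactly on [A]: the passage from a cube to one of
    half the side. *)
Definition child A w : {ffun 'I_d -> nat} := [ffun j => (j \in A) + (w j).*2].

Definition free_coord l : {set 'I_d} := [set j : 'I_d | j < b l]%SET.

Lemma card_free_coord l : #|free_coord l| = minn d (b l).
Proof.
rewrite -sum1_card (eq_bigl (fun j : 'I_d => j < b l)); last by move=> j; rewrite inE.
have [bd|db] := leqP (b l) d.
  by rewrite (big_ord_narrow bd) sum1_card card_ord; lia.
rewrite (eq_bigl predT) ?sum1_card; first by rewrite card_ord; lia.
by move=> j /=; have := ltn_ord j; lia.
Qed.

Definition children l (s : seq {ffun 'I_d -> nat}) :=
  [seq child A w | w <- s, A <- enum (powerset (free_coord l))].

Lemma size_children l s : size (children l s) = size s * 2 ^ minn d (b l).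
Proof. by rewrite size_allpairs -cardE card_powerset card_free_coord. Qed.

Lemma half_child A w j : (child A w j)./2 = w j.
Proof. by rewrite ffunE half_bit_double. Qed.

Lemma odd_child A w j : odd (child A w j) = (j \in A).
Proof. by rewrite ffunE oddD odd_double addbF; case: (j \in A). Qed.

Lemma child_inj A1 A2 w1 w2 :
  child A1 w1 = child A2 w2 -> (w1, A1) = (w2, A2).
Proof.
move=> e; congr (_, _).
  by apply/ffunP => j; rewrite -(half_child A1) e half_child.
by apply/setP => j; rewrite -(odd_child A1 w1) e odd_child.
Qed.

Lemma digit_prefix_children n l p s : l < n -> digits n p ->
  digit_prefix n l p \in s -> digit_prefix n l.+1 p \in children l s.
Proof.
move=> ln np ps; pose A := [set j | odd (p j %/ 2 ^ (n - l.+1))]%SET.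
have -> : digit_prefix n l.+1 p = child A (digit_prefix n l p).
  apply/ffunP => j; rewrite !ffunE inE (_ : n - l = (n - l.+1).+1); last lia.
  by rewrite expnSr divnMA divn2 odd_double_half.
apply: allpairs_f => //; rewrite mem_enum powersetE.
by apply/fintype.subsetP => j; rewrite !inE; apply: (np j).2.
Qed.

(** Points less than one cube side apart in each coordinate lie in equal or adjacent cubes, which
    leaves three choices per coordinate. *)
Lemma digit_prefix_near n k q : exists2 s, size s = 3 ^ d &
  forall p, (forall j, p j < q j + 2 ^ (n - k) /\ q j < p j + 2 ^ (n - k)) ->
    digit_prefix n k p \in s.
Proof.
(* The values 0, 1, 2 of [f j] code the offsets -1, 0, 1; the predecessor of 0 being 0 only creates
   a harmless repetition. *)
exists [seq [ffun j => (q j %/ 2 ^ (n - k) + f j).-1] | f : {ffun 'I_d -> 'I_3}].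
  by rewrite size_map -cardE card_ffun !card_ord.
set D := 2 ^ (n - k); have D0 : 0 < D by rewrite expn_gt0.
move=> p pq; have PQ j : p j %/ D <= (q j %/ D).+1 /\ q j %/ D <= (p j %/ D).+1.
  have near x y : x < y + D -> x %/ D <= (y %/ D).+1.
    by move=> /ltnW/(leq_div2r D); rewrite divnDr ?dvdnn // divnn D0 addn1.
  by split; apply: near; have [] := pq j.
apply/mapP; exists [ffun j => inord ((p j %/ D).+1 - q j %/ D)].
  by rewrite mem_enum.
apply/ffunP => j; rewrite !ffunE -/D; have := PQ j.
by move: (p j %/ D) (q j %/ D) => P Q [PQj QPj]; rewrite inordK; lia.
Qed.

(** Starting from the neighbouring cubes at level [k], level [i] multiplies their number by at most
    [2 ^ b i]. *)
Lemma digit_prefix_cover n k m q : k + m <= n -> exists2 s,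
    size s <= 3 ^ d * 2 ^ \sum_(k <= i < k + m) b i &
  forall p, digits n p ->
    (forall j, p j < q j + 2 ^ (n - k) /\ q j < p j + 2 ^ (n - k)) ->
    digit_prefix n (k + m) p \in s.
Proof.
elim: m => [|m IHm] kmn.
  have [s ss Hs] := digit_prefix_near n k q; rewrite addn0 big_geq // muln1.
  by exists s => [|p _]; [rewrite ss|apply: Hs].
have [|s ss Hs] := IHm _; first by lia.
exists (children (k + m) s) => [|p np pq].
  rewrite size_children addnS big_nat_recr ?leq_addr //= expnD mulnA.
  by rewrite leq_mul // leq_exp2l // geq_minr.
by rewrite addnS; apply: digit_prefix_children (Hs p np pq); rewrite // -addnS.
Qed.

(** The matching lower count: points whose first [k] digits vanish realise every choice of the later
    free digits, and [b i <= d] lets level [i] contribute exactly [b i] of them. *)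
Lemma digits_extend k m : (forall i, b i <= d) -> exists L,
  [/\ uniq L, size L = 2 ^ \sum_(k <= i < k + m) b i &
   forall p, p \in L -> digits (k + m) p /\ forall j, p j < 2 ^ m].
Proof.
move=> bd; elim: m => [|m [L [uL sL HL]]].
  exists [:: [ffun=> 0]]; split=> //; first by rewrite addn0 big_geq.
  move=> p; rewrite inE => /eqP ->; split=> j; rewrite ffunE ?expn0 //.
  by split=> [|l _]; rewrite ?expn_gt0 // div0n.
exists (children (k + m) L); split.
- apply: allpairs_uniq => //; first exact: enum_uniq.
  by move=> [w1 A1] [w2 A2] _ _ /= /child_inj.
- rewrite size_children sL (minn_idPr (bd _)) -expnD addnS.
  by rewrite big_nat_recr ?leq_addr.
move=> _ /allpairsP[[w A] /= [/HL[nw wm] + ->]].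
rewrite mem_enum powersetE => /fintype.subsetP sA.
have lt_child j N : w j < 2 ^ N -> child A w j < 2 ^ N.+1.
  by rewrite ffunE expnS; move: (2 ^ N) (j \in A) => M [] /=; lia.
split=> j; last exact: lt_child.
rewrite addnS; split=> [|l]; first by apply: lt_child; case: (nw j).
rewrite ltnS leq_eqVlt => /predU1P[->|lt].
  by rewrite subnn divn1 odd_child => /sA; rewrite inE.
rewrite (_ : _ - _ = (k + m - l.+1).+1); last lia.
by rewrite expnS divnMA divn2 half_child; apply: (nw j).2.
Qed.

End BinaryDigits.

(** * A union of separated dyadic sets and its covering numbers *)

Section DyadicTrees.
Variables (R : realType) (d : nat) (lev : nat -> nat -> nat).
Hypothesis lev_mono : forall n k, (lev n k.+1 <= lev n k)%N.
Hypothesis lev_lip : forall n k, (lev n k <= lev n k.+1 + d)%N.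
Hypothesis lev_end : forall n k, (n <= k)%N -> lev n k = 0%N.

(** [lev n k] is the binary logarithm of the number of points of piece [n] in an occupied cube of
    side 2^(-k); its drop counts the coordinates with a free digit at level [k]. *)
Definition drop_rate n k := (lev n k - lev n k.+1)%N.

Lemma lev_homo n k m : (lev n (k + m) <= lev n k)%N.
Proof. by elim: m => [|m IHm]; rewrite ?addn0 // addnS (leq_trans (lev_mono _ _)). Qed.

Lemma sum_drop_rate n k m :
  (\sum_(k <= i < k + m) drop_rate n i = lev n k - lev n (k + m))%N.
Proof.
elim: m => [|m IHm]; first by rewrite addn0 big_geq ?subnn.
rewrite addnS big_nat_recr ?leq_addr //= IHm /drop_rate.
by have := lev_mono n (k + m); have := lev_homo n k m; lia.
Qed.

Lemma lev_minn n k : lev n (minn k n) = lev n k.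
Proof.
by have [//|nk] := leqP k n; rewrite !lev_end // ltnW.
Qed.

(* For d > 0, distinct values of n give points at distance more than 1; for d = 0
   all the points coincide. *)
Definition dyadic_point n (p : {ffun 'I_d -> nat}) : 'rV[R]_d :=
  \row_j (3 * n%:R + (p j)%:R / 2 ^+ n).

Definition dyadic_forest : set 'rV[R]_d :=
  [set x | exists n p, digits (drop_rate n) n p /\ x = dyadic_point n p].

Let pow2_gt0 n : 0 < 2 ^+ n :> R. Proof. exact: exprn_gt0. Qed.

Lemma ltr_nat_pow2 n k (x : nat) : (k <= n)%N ->
  (x%:R / 2 ^+ n < 2 ^- k :> R) = (x < 2 ^ (n - k))%N.
Proof.
move=> kn; rewrite ltr_pdivrMr // -[in 2 ^+ n](subnK kn) exprD mulrC mulfK ?gt_eqF //.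
by rewrite -natrX ltr_nat.
Qed.

(** For [d > 0] the first coordinate lies in [3n, 3n + 1) on piece [n], so it tells the pieces
    apart; for [d = 0] the point [q] itself serves. *)
Lemma dyadic_forest_ball n q y : digits (drop_rate n) n q -> dyadic_forest y ->
  enorm (y - dyadic_point n q) < 1 ->
  exists2 p, digits (drop_rate n) n p & y = dyadic_point n p.
Proof.
move=> nq [m [p [mp ->]]] near; have [d0|d0] := posnP d.
  exists q => //; apply/rowP => j; have := ltn_ord j; rewrite {2}d0; lia.
pose i := Ordinal d0; have := le_lt_trans (coord_le_enorm _ i) near.
rewrite !mxE; have [pm _] := mp i; have [qn _] := nq i.
have: (p i)%:R / 2 ^+ m < 1 :> R by rewrite ltr_pdivrMr // mul1r -natrX ltr_nat.
have: (q i)%:R / 2 ^+ n < 1 :> R by rewrite ltr_pdivrMr // mul1r -natrX ltr_nat.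
have: 0 <= (q i)%:R / 2 ^+ n :> R by rewrite divr_ge0 // ltW.
have: 0 <= (p i)%:R / 2 ^+ m :> R by rewrite divr_ge0 // ltW.
case: (ltngtP m n) => [|| <-]; last by exists p.
- rewrite -(ler_nat R) -natr1 => mn ? ? ? ?; rewrite ltr_norml => /andP[? ?]; lra.
- rewrite -(ler_nat R) -natr1 => mn ? ? ? ?; rewrite ltr_norml => /andP[? ?]; lra.
Qed.

Lemma dyadic_forest_covers n q k l (delta r : R) :
  digits (drop_rate n) n q -> (k <= l)%N -> delta <= 2 ^- k -> 2 ^+ d * 2 ^- l <= r ->
  covers r (dyadic_forest `&` eball (dyadic_point n q) delta)
    (3 ^ d * 2 ^ (lev n k - lev n l)).
Proof.
move=> nq kl dk lr; pose k' := minn k n; pose m := (minn l n - k')%N.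
have mE : (k' + m = minn l n)%N by rewrite /m /k'; lia.
have [|s ss Hs] := @digit_prefix_cover d (drop_rate n) n k' m q; first lia.
apply/covers_seqP.
(* The centres are the lower corners of the cubes found; the depth is cut at [n], where the digits
   end. *)
exists [seq \row_j (3 * n%:R + (w j)%:R / 2 ^+ minn l n) | w : {ffun 'I_d -> nat} <- s].
  by rewrite size_map (leq_trans ss) // sum_drop_rate mE !lev_minn.
move=> y [Fy qy]; have d1 : delta <= 1.
  by rewrite (le_trans dk) // invf_le1 // exprn_ege1 // ler1n.
have [p np yE] := dyadic_forest_ball nq Fy (lt_le_trans qy d1).
have near j : (p j < q j + 2 ^ (n - k'))%N /\ (q j < p j + 2 ^ (n - k'))%N.
  have := le_lt_trans (coord_le_enorm _ j) qy; rewrite yE !mxE => pq.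
  have {pq} : `|(p j)%:R / 2 ^+ n - (q j)%:R / 2 ^+ n| < 2 ^- k' :> R.
    rewrite (_ : _ - _ / _ = 3 * n%:R + (p j)%:R / 2 ^+ n -
      (3 * n%:R + (q j)%:R / 2 ^+ n)); last ring.
    rewrite (lt_le_trans pq) // (le_trans dk) // lef_pV2 ?posrE //.
    by rewrite ler_weXn2l ?ler1n // geq_minl.
  rewrite -mulrBl normrM (gtr0_norm (_ : 0 < (2 ^+ n)^-1)) ?invr_gt0 //.
  rewrite ltr_pdivrMr // -{1}(subnK (geq_minr k n)) exprD mulrC mulfK ?gt_eqF //.
  rewrite ltr_norml => /andP[? ?]; rewrite -!(ltr_nat R) !natrD natrX.
  by split; lra.
exists (\row_j (3 * n%:R + (digit_prefix n (minn l n) p j)%:R / 2 ^+ minn l n)).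
  by rewrite -mE; apply: map_f (Hs p np near).
apply: lt_le_trans lr; apply: enorm_lt => [|j]; first by rewrite invr_gt0.
rewrite yE !mxE ffunE opprD addrACA subrr add0r.
set D := (n - minn l n)%N; have D0 : (0 < 2 ^ D)%N by rewrite expn_gt0.
rewrite {1}(divn_eq (p j) (2 ^ D)) natrD natrM mulrDl.
have -> : (p j %/ 2 ^ D)%:R * (2 ^ D)%:R / 2 ^+ n = (p j %/ 2 ^ D)%:R / 2 ^+ minn l n :> R.
  have -> : 2 ^+ n = 2 ^+ D * 2 ^+ minn l n :> R by rewrite -exprD subnK ?geq_minr.
  by rewrite natrX invfM mulrA mulfK ?gt_eqF.
rewrite addrAC subrr add0r ger0_norm; last by rewrite divr_ge0 // ltW.
have := ltn_pmod (p j) D0; rewrite /D; have [ln|nl] := leqP l n.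
  by rewrite ltr_nat_pow2.
(* Past depth [n] the prefix is the whole point, and the remainder modulo 1 is 0. *)
by rewrite subnn; case: (_ %% _)%N => // _; rewrite mul0r invr_gt0.
Qed.

(** Distinct points of piece [n] differ by at least 2^(-n) in some coordinate, so a ball of radius
    2^(-n-1) holds at most one of them. Those of the corner cube of level [k] all lie in the given
    ball. *)
Lemma dyadic_forest_count n k (delta : R) N : 2 ^+ d * 2 ^- k <= delta ->
  covers (2 ^- n.+1) (dyadic_forest `&` eball (dyadic_point n [ffun=> 0%N]) delta) N ->
  (2 ^ lev n k <= N)%N.
Proof.
move=> kdelta [c Hc]; pose k' := minn k n; pose m := (n - k')%N.
have mE : (k' + m = n)%N by rewrite subnKC ?geq_minr.
have [|L [uL sL HL]] := @digits_extend d (drop_rate n) k' m.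
  by move=> i; rewrite /drop_rate; have := lev_lip n i; lia.
rewrite sum_drop_rate mE (lev_end (leqnn n)) subn0 lev_minn in sL.
have /choice[f Hf] : forall u : seq_sub L,
    exists i : 'I_N, enorm (dyadic_point n (val u) - c i) < 2 ^- n.+1.
  move=> [p pL] /=; have [np pm] := HL p pL; rewrite mE in np.
  have [|i _ Hi] := Hc (dyadic_point n p); last by exists i.
  split; first by exists n, p.
  apply: lt_le_trans kdelta; apply: enorm_lt => [|j]; first by rewrite invr_gt0.
  rewrite !mxE !ffunE mul0r addr0 addrAC subrr add0r ger0_norm; last first.
    by rewrite divr_ge0 // ltW.
  have := pm j; rewrite /m /k'; have [kn|nk] := leqP k n; first by rewrite ltr_nat_pow2.
  by rewrite subnn; case: (p j) => // _; rewrite mul0r invr_gt0.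
have f_inj : injective f.
  move=> u v fuv; apply/val_inj/ffunP => j.
  have := le_lt_trans (coord_le_enorm _ j) (Hf u); rewrite fuv !mxE.
  have := le_lt_trans (coord_le_enorm _ j) (Hf v); rewrite !mxE.
  move: (val u) (val v) (c (f v) ord0 j) => p q z; rewrite !ltr_norml => /andP[q1 q2] /andP[p1 p2].
  have e2 : 2 ^- n.+1 = 2^-1 / 2 ^+ n :> R by rewrite exprS invfM.
  have lt1 : (p j)%:R / 2 ^+ n < ((q j)%:R + 1) / 2 ^+ n :> R by move: p2 q1; rewrite e2 !mulrDl; lra.
  have lt2 : (q j)%:R / 2 ^+ n < ((p j)%:R + 1) / 2 ^+ n :> R by move: p1 q2; rewrite e2 !mulrDl; lra.
  move: lt1 lt2; rewrite !ltr_pM2r ?invr_gt0 // !natr1 !ltr_nat; lia.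
by rewrite -sL -(card_seq_sub uL) -[X in (_ <= X)%N]card_ord (leq_card f).
Qed.

End DyadicTrees.

(** * Sufficiency: profiles built from [phi] *)

Section Realisation.
Variables (R : realType) (d : nat) (phi : R -> R).
Hypothesis phi_range : forall theta : R, 0 < theta < 1 -> 0 <= phi theta <= d%:R.
Hypothesis phi_ineq : forall lambda theta : R,
  0 < lambda -> lambda < theta -> theta < 1 ->
  0 <= (1 - lambda) * phi lambda - (1 - theta) * phi theta
    <= (theta - lambda) * phi (lambda / theta).

Let psi (t : R) := (1 - t) * phi t.

Let psi_ge0 t : 0 < t < 1 -> 0 <= psi t.
Proof. by move=> t01; have /andP[? _] := phi_range t01; rewrite mulr_ge0 //; lra. Qed.

Let psi_le t : 0 < t < 1 -> psi t <= d%:R * (1 - t).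
Proof.
by move=> t01; have /andP[_ ?] := phi_range t01; rewrite /psi mulrC ler_wpM2r //; lra.
Qed.

Let psi_mono s t : 0 < s -> s <= t -> t < 1 -> psi t <= psi s.
Proof.
move=> s0; rewrite le_eqVlt => /predU1P[->//|st] t1.
by have /andP[] := phi_ineq s0 st t1; rewrite subr_ge0.
Qed.

Let psi_sub s t : 0 < s < 1 -> 0 < t < 1 -> psi (s * t) <= psi t + t * psi s.
Proof.
move=> /andP[s0 s1] /andP[t0 t1]; have st0 : 0 < s * t by rewrite mulr_gt0.
have stt : s * t < t by rewrite gtr_pMl.
have /andP[_] := phi_ineq st0 stt t1; rewrite mulfK ?gt_eqF // /psi.
rewrite lerBlDl => /le_trans-> //.
by rewrite (_ : t * _ = (t - s * t) * phi s) //; ring.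
Qed.

(** Apply [psi_sub] with ratio [s / t] and bound its second term by [psi_le]: here [phi <= d]
    becomes a bound of [d] free digits per level. *)
Let psi_lip s t : 0 < s -> s <= t -> t < 1 -> psi s <= psi t + d%:R * (t - s).
Proof.
move=> s0; rewrite le_eqVlt => /predU1P[->|st] t1; first by rewrite subrr mulr0 addr0.
have t0 := lt_trans s0 st.
have q01 : 0 < s / t < 1 by rewrite divr_gt0 //= ltr_pdivrMr // mul1r.
have := psi_sub q01 (_ : 0 < t < 1); rewrite divfK ?gt_eqF // t0 t1 => /(_ isT).
move/le_trans; apply; rewrite lerD2l.
rewrite (_ : d%:R * (t - s) = t * (d%:R * (1 - s / t))); last by field; rewrite gt_eqF.
by rewrite ler_pM2l // psi_le.
Qed.

(** By monotonicity the supremum is the limit of [psi] at 0, and by [psi_le] its limit at 1 is 0, so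
    the extension is continuous. *)
Definition psi_ext (x : R) : R :=
  if x <= 0 then sup [set psi t | t in [set t | 0 < t < 1]]
  else if x < 1 then psi x else 0.

Let has_sup_psi : has_sup [set psi t | t in [set t | 0 < t < 1]].
Proof.
split; first by exists (psi 2^-1), 2^-1 => //=; lra.
exists d%:R => _ [t t01 <-]; rewrite (le_trans (psi_le t01)) // ler_piMr //.
by case/andP: t01 => t0 t1; lra.
Qed.

Let psi_ext0_ge t : 0 < t < 1 -> psi t <= psi_ext 0.
Proof.
by move=> t01; rewrite /psi_ext lexx; apply: sup_upper_bound => //; exists t.
Qed.

Lemma psi_ext_le0 x : x <= 0 -> psi_ext x = psi_ext 0.
Proof. by rewrite /psi_ext lexx => ->. Qed.

Lemma psi_extE t : 0 < t < 1 -> psi_ext t = (1 - t) * phi t.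
Proof. by move=> /andP[t0 t1]; rewrite /psi_ext leNgt t0 t1. Qed.

Lemma psi_ext_ge1 x : 1 <= x -> psi_ext x = 0.
Proof.
by move=> x1; rewrite /psi_ext leNgt (lt_le_trans ltr01 x1) /= ltNge x1.
Qed.

Let psi_ext0_le t : 0 < t < 1 -> psi_ext 0 <= psi t + d%:R * t.
Proof.
move=> /andP[t0 t1]; rewrite {1}/psi_ext lexx; apply: ge_sup; first by case: has_sup_psi.
move=> _ [s /andP[s0 s1] <-]; have [st|ts] := leP s t.
  by rewrite (le_trans (psi_lip s0 st t1)) // lerD2l ler_wpM2l //; lra.
by rewrite (le_trans (psi_mono t0 (ltW ts) s1)) // lerDl mulr_ge0 // ltW.
Qed.

Lemma psi_ext_mono x y : x <= y -> psi_ext y <= psi_ext x.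
Proof.
move=> xy; have [y0|y0] := leP y 0.
  by rewrite !psi_ext_le0 // (le_trans xy).
have ext0 : 0 <= psi_ext 0.
  by apply: (le_trans (psi_ge0 (_ : 0 < 2^-1 < 1)) (psi_ext0_ge _)); lra.
have [y1|y1] := leP 1 y.
  rewrite psi_ext_ge1 //; have [x0|x0] := leP x 0; first by rewrite psi_ext_le0.
  have [x1|x1] := leP 1 x; first by rewrite psi_ext_ge1.
  by rewrite psi_extE ?x0 // psi_ge0 ?x0.
rewrite psi_extE ?y0 //; have [x0|x0] := leP x 0.
  by rewrite psi_ext_le0 // psi_ext0_ge ?y0.
by rewrite psi_extE ?x0 ?(le_lt_trans xy) // psi_mono.
Qed.

Lemma psi_ext_lip x y : 0 <= x -> x <= y -> psi_ext x <= psi_ext y + d%:R * (y - x).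
Proof.
rewrite le_eqVlt => /predU1P[<-|x0] xy.
  move: xy; rewrite subr0 le_eqVlt => /predU1P[<-|y0]; first by rewrite mulr0 addr0.
  have [y1|y1] := leP 1 y; last by rewrite (psi_extE (t := y)) ?y0 // psi_ext0_le ?y0.
  rewrite (psi_ext_ge1 y1) add0r (@le_trans _ _ d%:R) ?ler_peMr //.
  rewrite {1}/psi_ext lexx; apply: ge_sup; first by case: has_sup_psi.
  move=> _ [t t01 <-]; rewrite (le_trans (psi_le t01)) // ler_piMr //.
  by case/andP: t01 => t0 t1; lra.
have [x1|x1] := leP 1 x.
  by rewrite !psi_ext_ge1 ?(le_trans x1) // add0r mulr_ge0 // subr_ge0.
have x01 : 0 < x < 1 by rewrite x0.
rewrite (psi_extE x01); have [y1|y1] := leP 1 y.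
  rewrite (psi_ext_ge1 y1) add0r (le_trans (psi_le x01)) // ler_wpM2l //; lra.
by rewrite psi_extE ?(lt_le_trans x0) // psi_lip.
Qed.

(** For [0 < x < 1] this is [psi_sub]; for [x >= 1], [psi_ext (t * x) <= psi t <= x * psi t]. The
    latter case serves scales finer than the depth of a piece. *)
Lemma psi_ext_sub t x : 0 < t < 1 -> 0 <= x ->
  psi_ext (t * x) <= psi_ext x + x * ((1 - t) * phi t).
Proof.
move=> t01; have [t0 t1] := andP t01.
rewrite le_eqVlt => /predU1P[<-|x0]; first by rewrite mulr0 mul0r addr0.
have [x1|x1] := leP 1 x; last first.
  rewrite !psi_extE ?x0 ?x1 //; first by apply: psi_sub; rewrite ?x0.
  by rewrite mulr_gt0 //= mulr_ilt1 // ltW.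
rewrite (psi_ext_ge1 x1) add0r (@le_trans _ _ (psi t)) ?ler_peMl ?psi_ge0 //.
by rewrite -[leRHS](psi_extE t01) psi_ext_mono // ler_peMr // ltW.
Qed.

(* The piece of parameter n has about 2^(n (psi u - psi v)) descendants at
   scale 2^(-n v) in each cube of side 2^(-n u). *)
Definition profile n (x : R) := n%:R * psi_ext (x / n%:R).

Lemma profile_mono n x y : x <= y -> profile n y <= profile n x.
Proof.
by move=> xy; rewrite ler_wpM2l // psi_ext_mono // ler_wpM2r // invr_ge0.
Qed.

Lemma profile_lip n x y : 0 <= x -> x <= y ->
  profile n x <= profile n y + d%:R * (y - x).
Proof.
move=> x0 xy; case: n => [|n].
  by rewrite /profile !mul0r add0r mulr_ge0 // subr_ge0.
have -> : d%:R * (y - x) = n.+1%:R * (d%:R * (y / n.+1%:R - x / n.+1%:R)).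
  by have : n.+1%:R != 0 :> R by []; move: n.+1%:R => N N0; field.
rewrite -mulrDr ler_wpM2l // psi_ext_lip ?divr_ge0 //.
by rewrite ler_wpM2r // invr_ge0.
Qed.

Lemma profile_end n x : n%:R <= x -> profile n x = 0.
Proof.
case: n => [|n] nx; first by rewrite /profile mul0r.
by rewrite /profile psi_ext_ge1 ?mulr0 // ler_pdivlMr ?mul1r.
Qed.

Lemma profile_ge0 n x : 0 <= profile n x.
Proof.
have [/profile_end-> //|/ltW/(profile_mono n)] := leP n%:R x.
by rewrite profile_end.
Qed.

Lemma profile_sub n t x : 0 < t < 1 -> 0 <= x ->
  profile n (t * x) <= profile n x + x * ((1 - t) * phi t).
Proof.
move=> t01 x0; case: n => [|n].
  by rewrite /profile !mul0r add0r mulr_ge0 // psi_ge0.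
rewrite /profile -mulrA -[x in leRHS](@divfK _ n.+1%:R) ?pnatr_eq0 //.
rewrite mulfK ?pnatr_eq0 // (_ : _ * n.+1%:R * _ =
  n.+1%:R * (x / n.+1%:R * ((1 - t) * phi t))); last ring.
by rewrite -mulrDr ler_wpM2l // psi_ext_sub // divr_ge0.
Qed.

Lemma profileE n t : (0 < n)%N -> 0 < t < 1 ->
  profile n (n%:R * t) = n%:R * ((1 - t) * phi t).
Proof.
by move=> n0 t01; rewrite /profile [_ * t]mulrC mulfK ?pnatr_eq0 -?lt0n // psi_extE.
Qed.

(** * Integer levels and the exponents of the resulting set *)

Definition level n k := Num.trunc (profile n k%:R).

Lemma level_le n k : (level n k)%:R <= profile n k%:R.
Proof. by rewrite truncn_le profile_ge0. Qed.

Lemma level_gt n k : profile n k%:R < (level n k)%:R + 1.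
Proof. by rewrite natr1 truncnS_gt. Qed.

Lemma level_mono n k : (level n k.+1 <= level n k)%N.
Proof. by rewrite le_truncn // profile_mono // ler_nat. Qed.

(** Truncation keeps the Lipschitz bound because [d] is an integer. *)
Lemma level_lip n k : (level n k <= level n k.+1 + d)%N.
Proof.
rewrite truncn_le_nat -natr1 natrD addrAC.
apply: le_lt_trans (_ : profile n k.+1%:R + d%:R < _); last by rewrite ltrD2r level_gt.
have := @profile_lip n k%:R k.+1%:R; rewrite ler0n ler_nat leqnSn => /(_ isT isT).
by rewrite -natr1 addrAC subrr add0r mulr1.
Qed.

Lemma level_end n k : (n <= k)%N -> level n k = 0%N.
Proof. by move=> nk; rewrite /level profile_end ?truncn0 // ler_nat. Qed.

Let forest : set 'rV[R]_d := dyadic_forest level.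

Let level_diff n k m :
  ((level n k - level n (k + m))%:R <= profile n k%:R - profile n (k + m)%:R + 1)%R.
Proof.
rewrite natrB; last exact: lev_homo level_mono _ _ _.
by have := level_le n k; have := level_gt n (k + m); lra.
Qed.

(** For [r = 2^(-rho)] the logarithm of the count is about [profile n (t * rho) - profile n rho],
    which [profile_sub] bounds by [rho * psi t] uniformly in [n]. *)
Lemma cover_exponent_forest t : 0 < t < 1 -> cover_exponent forest t ((1 - t) * phi t).
Proof.
(* The terms of [M] pay for rounding [t * rho] down to [k], for [l - rho <= d + 1], and for
   truncating levels. *)
move=> t01; have [t0 t1] := andP t01; pose M := (d + d * d.+1 + 1)%N.
exists (3 ^+ d * 2 ^+ M) => [|r x /andP[r0 r1] [n [q [nq ->]]]].
  by rewrite mulr_gt0 ?exprn_gt0.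
have ln2 : 0 < ln 2 :> R by rewrite ln_gt0 // ltr1n.
pose rho := - (ln r / ln 2).
have rE : r = 2 `^ (- rho).
  by rewrite /powR pnatr_eq0 /= /rho opprK divfK ?gt_eqF // lnK.
have rho0 : 0 <= rho by rewrite oppr_ge0 pmulr_lle0 ?invr_gt0 // ln_le0.
have trho0 : 0 <= t * rho by rewrite mulr_ge0 // ltW.
(* The shift [d.+1] makes [2 ^+ d * 2 ^- l <= r], absorbing the factor of [enorm_lt]. *)
pose k := Num.trunc (t * rho); pose l := (Num.trunc rho + d.+1)%N.
have /andP[kt tk] : k%:R <= t * rho < k%:R + 1 by rewrite natr1 truncn_itv.
have /andP[lr rl] : l%:R - d.+1%:R <= rho < l%:R - d%:R.
  have := truncn_itv rho0; rewrite /l natrD -[d.+1%:R]natr1 -[_.+1%:R]natr1.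
  by move=> /andP[? ?]; apply/andP; split; lra.
have trr : t * rho <= rho by rewrite ler_piMl // ltW.
have kl : (k <= l)%N.
  by rewrite /k /l (leq_trans (le_truncn trr)) // leq_addr.
clearbody k l; exists (3 ^ d * 2 ^ (level n k - level n l))%N.
  apply: dyadic_forest_covers => //; first exact: level_mono.
  - exact: level_end.
  - by rewrite rE -powRrM -powR_mulrn // -powRN ler_powR ?ler1n //; lra.
  - rewrite rE -!powR_mulrn // -powRN -powRD ?pnatr_eq0 ?implybT // ler_powR ?ler1n //; lra.
rewrite natrM !natrX -mulrA ler_pM2l ?exprn_gt0 // rE -powRrM -!powR_mulrn //.
rewrite -powRD ?pnatr_eq0 ?implybT // ler_powR ?ler1n //.
have := level_diff n k (l - k); rewrite subnKC // => /le_trans-> //.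
have := profile_lip n (ler0n R k) kt.
have rl' : rho <= l%:R by have := ler0n R d; lra.
have := profile_lip n rho0 rl'.
have := profile_sub n t01 rho0.
rewrite /M !natrD natrM; move: lr; rewrite -[d.+1%:R]natr1 => lr.
have : d%:R * (t * rho - k%:R) <= d%:R :> R by rewrite ler_piMr //; lra.
have : d%:R * (l%:R - rho) <= d%:R * (d%:R + 1) :> R by rewrite ler_wpM2l //; lra.
lra.
Qed.

(** At [r = 2^(-n-1)] and the corner of piece [n], about [2^(n * psi t)] balls are needed, more than
    [C * r^(-a)] for large [n] if [a < psi t]. *)
Lemma cover_exponent_forest_ge t a : 0 < t < 1 ->
  cover_exponent forest t a -> (1 - t) * phi t <= a.
Proof.
move=> t01 [C C0 HC]; have [t0 t1] := andP t01; rewrite leNgt; apply/negP => a_lt.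
(* [M] collects the Lipschitz loss from [k - n * t <= d + 2] and the truncation loss 1. *)
pose K := (Num.trunc C).+1; pose M := (d * d.+2 + 1)%N.
have CK : C <= 2 ^+ K.
  rewrite (le_trans (ltW (truncnS_gt C))) // -/K -natrX ler_nat ltnW //.
  exact: ltn_expl.
(* Beyond [X], [n * psi t - M] exceeds [K + (n + 1) * a], the binary logarithm of the upper
   bound. *)
pose X := (M%:R + a + K%:R) / ((1 - t) * phi t - a).
pose n := (Num.trunc X).+1; have Xn : X < n%:R := truncnS_gt X.
have n_gt0 : (0 < n)%N by [].
have n0 : digits (drop_rate level n) n ([ffun=> 0%N] : {ffun 'I_d -> nat}).
  by move=> j; rewrite ffunE expn_gt0; split=> // l _; rewrite div0n.
pose r : R := 2 ^- n.+1; have r2 : r = 2 `^ (- n.+1%:R) by rewrite powRN powR_mulrn.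
have r01 : 0 < r <= 1.
  by rewrite invr_gt0 exprn_gt0 //= invf_le1 ?exprn_gt0 // exprn_ege1 // ler1n.
have [|N cov NC] := HC r (dyadic_point R n [ffun=> 0%N]) r01; first by exists n, [ffun=> 0%N].
have nt0 : 0 <= n.+1%:R * t by rewrite mulr_ge0 // ltW.
pose k := (Num.trunc (n.+1%:R * t) + d.+1)%N.
have /andP[kt tk] : k%:R - d.+1%:R <= n.+1%:R * t < k%:R - d%:R.
  have := truncn_itv nt0; rewrite /k natrD -[d.+1%:R]natr1 -[(Num.trunc _).+1%:R]natr1.
  by move=> /andP[? ?]; apply/andP; split; lra.
clearbody k n; have count : (2 ^ level n k <= N)%N.
  apply: dyadic_forest_count cov; [exact: level_mono|exact: level_lip|exact: level_end|].
  rewrite r2 -powRrM -!powR_mulrn // -powRN -powRD ?pnatr_eq0 ?implybT // ler_powR ?ler1n //.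
  lra.
have : 2 ^+ level n k <= 2 ^+ K * r `^ (- a).
  rewrite -natrX (le_trans _ (le_trans NC _)) ?ler_nat //.
  by rewrite ler_wpM2r // powR_ge0.
rewrite r2 -powRrM -!powR_mulrn // -powRD ?pnatr_eq0 ?implybT //.
rewrite -ler_ln ?posrE ?powR_gt0 // !ln_powR ler_pM2r ?ln_gt0 ?ltr1n //.
rewrite leNgt => /negP; apply; move: Xn; rewrite /X ltr_pdivrMr ?subr_gt0 // => Xn.
have nk : n%:R * t <= k%:R.
  have := ler0n R d; move: kt tk; rewrite -[n.+1%:R]natr1 -[d.+1%:R]natr1; nra.
have := profile_lip n _ nk; rewrite profileE // mulr_ge0 ?(ltW t0) // => /(_ isT).
have : d%:R * (k%:R - n%:R * t) <= d%:R * (d%:R + 2) :> R.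
  rewrite ler_wpM2l //; move: kt tk; rewrite -[n.+1%:R]natr1 -[d.+1%:R]natr1; nra.
have := level_gt n k.
move: Xn; rewrite /M natrD natrM -[d.+2%:R]natr1 -[d.+1%:R]natr1 -[n.+1%:R]natr1; nra.
Qed.

Lemma spectrum_realised : exists F : set 'rV[R]_d,
  forall theta : R, 0 < theta < 1 -> assouad_spectrum theta F = (phi theta)%:E.
Proof.
exists forest => t t01; apply/spectrum_eqP => //; split=> a.
  by move/ltW/cover_exponent_le; apply; apply: cover_exponent_forest.
exact: cover_exponent_forest_ge.
Qed.

End Realisation.

Theorem theoremA (R : realType) (d : nat) (phi : R -> R)
    (phi_range : forall theta : R, 0 < theta < 1 -> 0 <= phi theta <= d%:R) :
  (exists F : set 'rV[R]_d,
     forall theta : R, 0 < theta < 1 ->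
       assouad_spectrum theta F = (phi theta)%:E) <->
  (forall lambda theta : R, 0 < lambda -> lambda < theta -> theta < 1 ->
     0 <= (1 - lambda) * phi lambda - (1 - theta) * phi theta
       <= (theta - lambda) * phi (lambda / theta)).
Proof.
split=> [[F HF]|phi_ineq]; first exact: spectrum_necessary HF.
exact: spectrum_realised.
Qed.
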